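(* Let $f:\mathbb{R}^n\to\mathbb{R}$ be differentiable, $L$-smooth and $\mu$-strongly convex ($L>0$, $0\le\mu\le L$) with a minimizer $x_*$. Let $\gamma_{t+1}\in(0,2/L)$, $\Delta_\gamma:=\gamma_{t+1}(1-L\gamma_{t+1}/2)$, and let $y_t,z_t\in\mathbb{R}^n$ and $A_t,B_t>0$ be given. Let $\xi_{t+1}\in[2\mu\Delta_\gamma,1)$ satisfy $$\frac{\xi_{t+1}(\xi_{t+1}-2\mu\Delta_\gamma)}{1-\xi_{t+1}}=4\Delta_\gamma\cdot\frac{B_t}{A_t},$$ and set $$A_{t+1}=\frac{A_t}{1-\xi_{t+1}},\quad B_{t+1}=\frac{\xi_{t+1}^2}{1-\xi_{t+1}}\cdot\frac{A_t}{4\Delta_\gamma},\quad \alpha_{t+1}=\frac{\xi_{t+1}-2\mu\Delta_\gamma}{1-2\mu\Delta_\gamma},\quad \beta_{t+1}=1-2\mu\Delta_\gamma\xi_{t+1}^{-1},\quad \eta_{t+1}=2\Delta_\gamma\xi_{t+1}^{-1}.$$ Define $$x_{t+1}=y_t+\alpha_{t+1}(z_t-y_t),\quad y_{t+1}=x_{t+1}-\gamma_{t+1}\nabla f(x_{t+1}),\quad z_{t+1}=x_{t+1}+\beta_{t+1}(z_t-x_{t+1})-\eta_{t+1}\nabla f(x_{t+1}).$$ Then $\Phi_{t+1}\le\Phi_t$, where $\Phi_s:=A_s(f(y_s)-f(x_* ))+B_s\|z_s-x_*\|^2$ for $s\in\{t,t+1\}$. In other words, $$f(y_{t+1})-f(x_*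 )+\frac{\xi_{t+1}^2}{4\Delta_\gamma}\|z_{t+1}-x_*\|^2\le(1-\xi_{t+1})\Big[f(y_t)-f(x_* )+\frac{B_t}{A_t}\|z_t-x_*\|^2\Big].$$
   Context: $\|\cdot\|$ is the Euclidean norm. $L$-smooth means $f(y)\le f(x)+\langle\nabla f(x),y-x\rangle+\frac L2\|x-y\|^2$ for all $x,y$; $\mu$-strongly convex means $f(y)\ge f(x)+\langle\nabla f(x),y-x\rangle+\frac\mu2\|x-y\|^2$ for all $x,y$ ($\mu=0$ being plain convexity). *)

(* Defs.v *)
From HB Require Import structures.
From mathcomp Require Import all_boot all_order all_algebra.
From mathcomp Require Import all_classical all_reals all_analysis.

Set Implicit Arguments.
Unset Strict Implicit.
Unset Printing Implicit Defensive.

Import Order.TTheory GRing.Theory Num.Theory.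
Import numFieldNormedType.Exports.

Local Open Scope ring_scope.

Definition dotp (R : realType) (n : nat) (u v : 'rV[R]_n) : R :=
  \sum_(i < n) u 0 i * v 0 i.

(* The library norm `|u| on row vectors is the sup norm, so the Euclidean norm
   is defined here. The two are equivalent, so differentiability is the same
   notion for both. *)
Definition enorm (R : realType) (n : nat) (u : 'rV[R]_n) : R :=
  Num.sqrt (dotp u u).

Definition grad (R : realType) (n : nat) (f : 'rV[R]_n -> R) (x : 'rV[R]_n) :
    'rV[R]_n :=
  \row_(i < n) 'D_(delta_mx 0 i) f x.

Definition smooth (R : realType) (n : nat) (L : R) (f : 'rV[R]_n -> R) : Prop :=
  forall x y : 'rV[R]_n,
    f y <= f x + dotp (grad f x) (y - x) + L / 2 * enorm (x - y) ^+ 2.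

Definition strongly_convex (R : realType) (n : nat) (mu : R)
    (f : 'rV[R]_n -> R) : Prop :=
  forall x y : 'rV[R]_n,
    f y >= f x + dotp (grad f x) (y - x) + mu / 2 * enorm (x - y) ^+ 2.

Definition minimizer (R : realType) (n : nat) (f : 'rV[R]_n -> R)
    (xs : 'rV[R]_n) : Prop :=
  forall x : 'rV[R]_n, f xs <= f x.

Definition Phi (R : realType) (n : nat) (f : 'rV[R]_n -> R) (xs : 'rV[R]_n)
    (A B : R) (y z : 'rV[R]_n) : R :=
  A * (f y - f xs) + B * enorm (z - xs) ^+ 2.

(* Main.v *)
Require Import Defs.
From HB Require Import structures.
From mathcomp Require Import all_boot all_order all_algebra.
From mathcomp Require Import all_classical all_reals all_analysis.
From mathcomp Require Import ring lra.
Import Order.TTheory GRing.Theory Num.Theory.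
Import numFieldNormedType.Exports.
Local Open Scope ring_scope.

(** Write [g] for the gradient at [x1], [w = x1 - xs], [u = zt - x1] and
    [q = 2 * mu * Dg].  The proof adds up three first-order inequalities at [x1]:
    the descent inequality [f y1 <= f x1 - Dg * |g|^2], and the convexity lower
    bounds at [xs], with weight [xi1], and at [yt], with weight [1 - xi1]; the
    quadratic term of the last one is discarded.  The sum bounds
    [f y1 - f xs - (1 - xi1) * (f yt - f xs)] by terms in [|g|^2], [<g, w>],
    [<g, yt - x1>] and [|w|^2].  The parameters are chosen so that all of them
    cancel against the expansion of [xi1^2 / (4 * Dg) * |z1 - xs|^2]
    ([dotp_dual_step]):
    - the step [eta1] produces exactly [Dg * |g|^2 - xi1 * <g, w>];
    - the interpolation weight [alpha1] makes [(1 - xi1) * (yt - x1)] equal to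
      [- (xi1 - q) * u] ([interpolation_offset]), which removes the remaining
      inner product with [g];
    - the contraction [beta1] splits the quadratic part into
      [xi1 * (xi1 - q) / (4 * Dg) * |zt - xs|^2], whose coefficient is
      [(1 - xi1) * Bt / At] by the equation defining [xi1], plus a multiple of
      [|w|^2] absorbed by strong convexity at [xs].

    What is left over is [- q * (xi1 - q) / (4 * Dg) * |u|^2], which is
    nonpositive because [0 <= q <= xi1].  The decrease of the potential is this
    one-step contraction multiplied by [At / (1 - xi1)]. *)

Section EuclideanProduct.
Context {R : realType} {n : nat}.
Implicit Types (a : R) (u v w : 'rV[R]_n).

Lemma dotpC u v : dotp u v = dotp v u.
Proof. by apply: eq_bigr => i _; rewrite mulrC. Qed.

Lemma dotpDl u v w : dotp (u + v) w = dotp u w + dotp v w.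
Proof. by rewrite -big_split; apply: eq_bigr => i _; rewrite mxE mulrDl. Qed.

Lemma dotpZl a u v : dotp (a *: u) v = a * dotp u v.
Proof. by rewrite /dotp mulr_sumr; apply: eq_bigr => i _; rewrite mxE mulrA. Qed.

Lemma dotpNl u v : dotp (- u) v = - dotp u v.
Proof. by rewrite -scaleN1r dotpZl mulN1r. Qed.

Lemma dotpDr u v w : dotp u (v + w) = dotp u v + dotp u w.
Proof. by rewrite !(dotpC u) dotpDl. Qed.

Lemma dotpZr a u v : dotp u (a *: v) = a * dotp u v.
Proof. by rewrite !(dotpC u) dotpZl. Qed.

Lemma dotpNr u v : dotp u (- v) = - dotp u v.
Proof. by rewrite !(dotpC u) dotpNl. Qed.

Lemma dotpp_ge0 u : 0 <= dotp u u.
Proof. by apply: sumr_ge0 => i _; rewrite -expr2 sqr_ge0. Qed.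

Lemma sqr_enorm u : enorm u ^+ 2 = dotp u u.
Proof. by rewrite /enorm sqr_sqrtr // dotpp_ge0. Qed.

Definition dotpE := (dotpDl, dotpDr, dotpNl, dotpNr, dotpZl, dotpZr).

(** Expansion of the new distance term.  The square is completed so that the
    old distance [|u + w|^2] appears with the coefficient prescribed by the
    recurrence for [xi], and the only other squares are the one paid by strong
    convexity and one of favourable sign. *)
Lemma dotp_dual_step (D q xi : R) (w u g : 'rV[R]_n) : D != 0 -> xi != 0 ->
  let z := w + (1 - q * xi^-1) *: u - (2 * D * xi^-1) *: g in
  xi ^+ 2 / (4 * D) * dotp z z =
    D * dotp g g - xi * dotp g w - (xi - q) * dotp g u
    + xi * (xi - q) / (4 * D) * dotp (u + w) (u + w)
    + xi * q / (4 * D) * dotp w w - q * (xi - q) / (4 * D) * dotp u u.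
Proof.
move=> D0 xi0 /=; rewrite !dotpE (dotpC w u) (dotpC w g) (dotpC u g).
by field; rewrite D0 xi0.
Qed.

(** With [a = (xi - q) / (1 - q)] one has [a / (1 - a) = (xi - q) / (1 - xi)],
    the ratio in which the interpolated point divides the segment. *)
Lemma interpolation_offset (q xi : R) (x y z : 'rV[R]_n) : q != 1 ->
  x = y + ((xi - q) / (1 - q)) *: (z - y) ->
  (1 - xi) *: (y - x) = - ((xi - q) *: (z - x)).
Proof.
move=> q1 ->; apply/rowP => i; rewrite !mxE.
by field; rewrite subr_eq0 eq_sym.
Qed.

Lemma smooth_gradient_step (L gam : R) (f : 'rV[R]_n -> R) x : smooth L f ->
  f (x - gam *: grad f x)
    <= f x - gam * (1 - L * gam / 2) * dotp (grad f x) (grad f x).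
Proof.
move=> /(_ x (x - gam *: grad f x)) /le_trans; apply.
rewrite sqr_enorm.
have -> : x - gam *: grad f x - x = - (gam *: grad f x) by rewrite addrC addKr.
have -> : x - (x - gam *: grad f x) = gam *: grad f x by rewrite opprB addrC subrK.
by rewrite !dotpE le_eqVlt; apply/orP; left; apply/eqP; field.
Qed.

Lemma strongly_convex_lower_bound (mu : R) (f : 'rV[R]_n -> R) x y :
  0 <= mu -> strongly_convex mu f -> f x + dotp (grad f x) (y - x) <= f y.
Proof.
move=> mu0 /(_ x y); apply: le_trans.
by rewrite lerDl mulr_ge0 ?divr_ge0 // exprn_ge0 // sqrtr_ge0.
Qed.

End EuclideanProduct.

Theorem theorem2p1 (R : realType) (n : nat) (f : 'rV[R]_n -> R) (L mu : R)
    (xs : 'rV[R]_n) (gam1 Dg : R) (yt zt : 'rV[R]_n) (At Bt xi1 : R)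
    (A1 B1 alpha1 beta1 eta1 : R) (x1 y1 z1 : 'rV[R]_n)
    (f_diff : forall x, differentiable f x)
    (L_gt0 : 0 < L) (mu_ge0 : 0 <= mu) (mu_leL : mu <= L)
    (f_smooth : smooth L f) (f_convex : strongly_convex mu f)
    (xs_min : minimizer f xs)
    (gam1_gt0 : 0 < gam1) (gam1_lt : gam1 < 2 / L)
    (DgE : Dg = gam1 * (1 - L * gam1 / 2))
    (At_gt0 : 0 < At) (Bt_gt0 : 0 < Bt)
    (xi1_ge : 2 * mu * Dg <= xi1) (xi1_lt1 : xi1 < 1)
    (xi1E : xi1 * (xi1 - 2 * mu * Dg) / (1 - xi1) = 4 * Dg * (Bt / At))
    (A1E : A1 = At / (1 - xi1))
    (B1E : B1 = xi1 ^+ 2 / (1 - xi1) * (At / (4 * Dg)))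
    (alpha1E : alpha1 = (xi1 - 2 * mu * Dg) / (1 - 2 * mu * Dg))
    (beta1E : beta1 = 1 - 2 * mu * Dg * xi1^-1)
    (eta1E : eta1 = 2 * Dg * xi1^-1)
    (x1E : x1 = yt + alpha1 *: (zt - yt))
    (y1E : y1 = x1 - gam1 *: grad f x1)
    (z1E : z1 = x1 + beta1 *: (zt - x1) - eta1 *: grad f x1) :
  Phi f xs A1 B1 y1 z1 <= Phi f xs At Bt yt zt
  /\ f y1 - f xs + xi1 ^+ 2 / (4 * Dg) * enorm (z1 - xs) ^+ 2
     <= (1 - xi1) * (f yt - f xs + Bt / At * enorm (zt - xs) ^+ 2).
Proof.
have D_gt0 : 0 < Dg.
  rewrite DgE mulr_gt0 //; move: gam1_lt; rewrite ltr_pdivlMr //.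
  by rewrite mulrC => ?; lra.
set q := 2 * mu * Dg in xi1_ge xi1E alpha1E beta1E *.
have q_ge0 : 0 <= q by rewrite !mulr_ge0 // ltW.
have xi_gt0 : 0 < xi1.
  (* for [xi1 = 0] the equation defining [xi1] would have a zero left side *)
  rewrite lt_neqAle (le_trans q_ge0 xi1_ge) andbT eq_sym; apply/eqP => xi0.
  have : 0 < 4 * Dg * (Bt / At) by rewrite !mulr_gt0 // invr_gt0.
  by rewrite -xi1E xi0 !mul0r ltxx.
have D_neq0 : Dg != 0 by rewrite gt_eqF.
have xi_neq0 : xi1 != 0 by rewrite gt_eqF.
have xi'_gt0 : 0 < 1 - xi1 by rewrite subr_gt0.
have xi'_neq0 : 1 - xi1 != 0 by rewrite gt_eqF.
have At_neq0 : At != 0 by rewrite gt_eqF.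
have q_neq1 : q != 1 by rewrite lt_eqF // (le_lt_trans xi1_ge).
set g := grad f x1 in y1E z1E *.
have step : f y1 - f xs + xi1 ^+ 2 / (4 * Dg) * enorm (z1 - xs) ^+ 2
     <= (1 - xi1) * (f yt - f xs + Bt / At * enorm (zt - xs) ^+ 2).
  have descent : f y1 <= f x1 - Dg * dotp g g.
    by rewrite y1E DgE; apply: smooth_gradient_step.
  have at_xs : f x1 - dotp g (x1 - xs) + mu / 2 * dotp (x1 - xs) (x1 - xs)
      <= f xs.
    by rewrite -sqr_enorm -dotpNr opprB; apply: f_convex.
  have at_yt := strongly_convex_lower_bound mu f x1 yt mu_ge0 f_convex.
  have offset : (1 - xi1) * dotp g (yt - x1) = - ((xi1 - q) * dotp g (zt - x1)).
    rewrite -dotpZr -dotpZr -dotpNr; congr dotp.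
    by apply: interpolation_offset => //; rewrite -alpha1E.
  have BtE : (1 - xi1) * (Bt / At) = xi1 * (xi1 - q) / (4 * Dg).
    have -> : xi1 * (xi1 - q) = (1 - xi1) * (4 * Dg * (Bt / At)).
      by rewrite -xi1E [RHS]mulrC divfK.
    by field; rewrite D_neq0 At_neq0.
  have strongE : xi1 * q / (4 * Dg) = xi1 * (mu / 2) by rewrite /q; field.
  have leftover : 0 <= q * (xi1 - q) / (4 * Dg) * dotp (zt - x1) (zt - x1).
    by rewrite mulr_ge0 ?dotpp_ge0 // divr_ge0 // mulr_ge0 ?subr_ge0 // ltW.
  rewrite !sqr_enorm mulrDr (mulrA (1 - xi1) (Bt / At)) BtE.
  have -> : z1 - xs = (x1 - xs) + (1 - q * xi1^-1) *: (zt - x1)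
                      - (2 * Dg * xi1^-1) *: g.
    by rewrite z1E beta1E eta1E; apply/rowP => i; rewrite !mxE; ring.
  have -> : zt - xs = (zt - x1) + (x1 - xs) by rewrite addrA subrK.
  rewrite dotp_dual_step // strongE.
  have := ler_wpM2l (ltW xi_gt0) at_xs.
  have := ler_wpM2l (ltW xi'_gt0) at_yt.
  rewrite mulrDr -/g offset; lra.
split=> //.
have scale_gt0 : 0 < At / (1 - xi1) by rewrite divr_gt0.
rewrite -(ler_pM2l scale_gt0) in step.
rewrite /Phi A1E B1E; move: step; congr (_ <= _).
  by field; rewrite D_neq0 xi'_neq0.
by field; rewrite At_neq0 xi'_neq0.
Qed.
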